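(* Let $G$ be a locally compact $\sigma$-compact (Hausdorff) group and let $H$ be an amenable discrete subgroup of $G$. If $\alpha = \sum_{h\in H} a_h h$ is a non-zerodivisor in the group ring $\mathbb{C}H$, then $\alpha \ast f := \sum_h a_h L_h f \neq 0$ for every nonzero $f \in L^2(G)$.
   Context: $L^2(G)$ is with respect to left Haar measure and $L_h f(x) = f(h^{-1}x)$. A non-zerodivisor in $\mathbb{C}H$ is an element $\alpha$ with $\alpha\beta\neq0$ and $\beta\alpha\neq 0$ for all nonzero $\beta\in\mathbb{C}H$. *)

(* Defs.v *)
From HB Require Import structures.
From mathcomp Require Import all_boot all_order all_algebra.
From mathcomp Require Import all_classical all_reals all_analysis.
From mathcomp Require Import complex.

Set Implicit Arguments.
Unset Strict Implicit.
Unset Printing Implicit Defensive.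

Import Order.TTheory GRing.Theory Num.Theory.
Local Open Scope classical_set_scope.
Local Open Scope ring_scope.

Definition group_law {G : Type} (mul : G -> G -> G) (inv : G -> G) (one : G) :=
  [/\ associative mul, left_id one mul & forall x, mul (inv x) x = one].

Definition topological_group (G : ptopologicalType)
    (mul : G -> G -> G) (inv : G -> G) (one : G) :=
  [/\ group_law mul inv one,
      continuous (fun p : G * G => mul p.1 p.2) & continuous inv].

Definition sigma_compact (G : ptopologicalType) :=
  exists K : nat -> set G, (forall n, compact (K n)) /\ \bigcup_n K n = [set: G].

Definition is_subgroup {G : Type} (mul : G -> G -> G) (inv : G -> G) (one : G)
    (H : set G) :=
  [/\ H one, (forall x y, H x -> H y -> H (mul x y)) & (forall x, H x -> H (inv x))].

Definition discrete_subset (G : ptopologicalType) (H : set G) :=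
  forall h, H h -> exists U : set G, [/\ open U, U h & U `&` H = [set h]].

Definition amenable_discrete (R : realType) {G : Type} (mul : G -> G -> G)
    (H : set G) :=
  exists m : set G -> R,
    [/\ m H = 1,
        (forall A, A `<=` H -> 0 <= m A),
        (forall A B, A `<=` H -> B `<=` H -> A `&` B = set0 ->
            m (A `|` B) = m A + m B) &
        (forall h A, H h -> A `<=` H -> m (mul h @` A) = m A)].

Definition borelG (G : ptopologicalType) := g_sigma_algebraType (@open G).

Definition left_haar_measure (R : realType) (G : ptopologicalType)
    (mul : G -> G -> G) (mu : set (borelG G) -> \bar R) :=
  [/\ mu [set: G] != 0%E,
      (forall g (A : set G), measurable (A : set (borelG G)) ->
          mu (mul g @` A) = mu A),
      (forall K : set G, compact K -> (mu K < +oo)%E),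
      (forall A : set G, measurable (A : set (borelG G)) ->
          mu A = ereal_inf [set mu U | U in [set U : set G | open U /\ A `<=` U]]) &
      (forall U : set G, open U ->
          mu U = ereal_sup [set mu K | K in [set K : set G | compact K /\ K `<=` U]])].

Definition cnorm2 (R : realType) (z : R[i]) : R := (@complex.Re R z) ^+ 2 + (@complex.Im R z) ^+ 2.

(* f is (a representative of) an element of L^2(G, mu) *)
Definition in_L2 (R : realType) (G : ptopologicalType)
    (mu : {measure set (borelG G) -> \bar R}) (f : G -> R[i]) :=
  [/\ measurable_fun [set: borelG G] (fun x : borelG G => @complex.Re R (f x)),
      measurable_fun [set: borelG G] (fun x : borelG G => @complex.Im R (f x)) &
      (\int[mu]_x (cnorm2 (f x))%:E < +oo)%E].

Definition ae_zero (R : realType) (G : ptopologicalType)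
    (mu : {measure set (borelG G) -> \bar R}) (f : G -> R[i]) :=
  {ae mu, forall x : borelG G, f x = 0}.

Definition csupport (R : realType) {G : Type} (a : G -> R[i]) := [set g | a g != 0].

(* a : G -> C represents an element sum_h a_h h of CH *)
Definition in_group_ring (R : realType) {G : Type} (H : set G) (a : G -> R[i]) :=
  finite_set (csupport a) /\ csupport a `<=` H.

Definition gr_mul (R : realType) {G : choiceType} (mul : G -> G -> G) (inv : G -> G)
    (a b : G -> R[i]) : G -> R[i] :=
  fun g => \sum_(h \in csupport a) a h * b (mul (inv h) g).

Definition non_zerodivisor (R : realType) {G : choiceType} (mul : G -> G -> G)
    (inv : G -> G) (H : set G) (a : G -> R[i]) :=
  forall b : G -> R[i], in_group_ring H b -> b <> (fun _ => 0) ->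
    gr_mul mul inv a b <> (fun _ => 0) /\ gr_mul mul inv b a <> (fun _ => 0).

Definition left_transl {G : Type} {T : Type} (mul : G -> G -> G) (inv : G -> G)
    (h : G) (f : G -> T) : G -> T := fun x => f (mul (inv h) x).

Definition gr_act (R : realType) {G : choiceType} (mul : G -> G -> G) (inv : G -> G)
    (a : G -> R[i]) (f : G -> R[i]) : G -> R[i] :=
  fun x => \sum_(h \in csupport a) a h * left_transl mul inv h f x.

(* Main.v *)
(** For almost every x the orbit function h |-> f (h x) is in l^2(H), since some
    neighbourhood W of the identity has disjoint translates h W y, h in H, for
    every y, and countably many of the sets W y cover G. If a * f = 0 then a
    annihilates almost every orbit function, so it suffices to show that a acts
    injectively on l^2(H).

    Amenability gives Folner sets: a finite T with |T F| >= 2 |F| for all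
    finite F would give, by Hall's marriage theorem, two injections of H into
    itself with disjoint ranges which are piecewise translations, whereas an
    invariant mean gives each range the mass 1. If x in l^2(H) is killed by a
    and x g <> 0, the right translates of x restricted to a Folner set F span a
    space of dimension at least |x g|^2 |F| / |x|^2 in C^F, which a maps into
    the functions on a boundary of F of smaller cardinal. So a kills a nonzero
    finitely supported function, and is a zero divisor. *)

Require Import Defs.
From HB Require Import structures.
From mathcomp Require Import all_boot all_order all_algebra finmap.
From mathcomp Require Import all_classical all_reals all_analysis.
From mathcomp Require Import measurable_realfun.
From mathcomp Require Import complex spectral ring lra.

Set Implicit Arguments.
Unset Strict Implicit.
Unset Printing Implicit Defensive.

Import Order.TTheory GRing.Theory Num.Theory.
Local Open Scope classical_set_scope.
Local Open Scope ring_scope.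

(** * Hall's marriage theorem for arbitrary families of finite sets *)

Definition hall (I U : choiceType) (B : I -> {fset U}) :=
  forall J : {fset I}, (#|` J| <= #|` (\bigcup_(i <- J) B i)%fset|)%N.

Definition subfamily (I U : choiceType) (B B' : I -> {fset U}) :=
  forall i, (B i `<=` B' i)%fset.

Lemma bigfcup_fsetU1 (I U : choiceType) (B : I -> {fset U}) i (J : {fset I}) :
  (\bigcup_(k <- i |` J) B k = B i `|` \bigcup_(k <- J) B k)%fset.
Proof.
apply/fsetP => x; apply/bigfcupP/idP => [[k /[!andbT] /fset1UP[->|kJ] xk]|].
- by rewrite in_fsetU xk.
- by rewrite in_fsetU; apply/orP; right; apply/bigfcupP; exists k; rewrite ?kJ.
- rewrite in_fsetU => /orP[xi|/bigfcupP[k /[!andbT] kJ xk]].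
    by exists i; rewrite ?fset1U1.
  by exists k; rewrite ?andbT// in_fset1U kJ orbT.
Qed.

Lemma eq_bigfcup (I U : choiceType) (B B' : I -> {fset U}) (J : {fset I}) :
  (forall i, i \in J -> B i = B' i) ->
  (\bigcup_(i <- J) B i = \bigcup_(i <- J) B' i)%fset.
Proof. by move=> BB'; apply: eq_big_seq => i /BB'. Qed.

(* On finitely many indices a chain of families of finite sets stabilizes. *)
Lemma hall_chain_inf (I U : choiceType) (F : set (I -> {fset U}))
    (B0 : I -> {fset U}) :
  F B0 -> (forall B, F B -> hall B) -> total_on F (@subfamily I U) ->
  exists2 B, hall B & forall B', F B' -> subfamily B B'.
Proof.
move=> FB0 Fhall Ftot.
(* At each index a member of the chain with the smallest [B i] lies below all others there, by
   totality. *)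
have minF i : exists B, F B /\ forall B', F B' -> (B i `<=` B' i)%fset.
  pose P n := `[< exists2 B, F B & #|` B i| = n >].
  have exP : exists n, P n by exists #|` B0 i|; apply/asboolP; exists B0.
  case: (ex_minnP exP) => n /asboolP[B FB Bn] nmin; exists B; split=> // B' FB'.
  have [/(_ i)//|/(_ i) B'B] := Ftot _ _ FB FB'.
  suff -> : B' i = B i by [].
  apply/eqP; rewrite eqEfcard B'B/= Bn; apply: nmin; apply/asboolP.
  by exists B'.
(* The diagonal [c i i] is the pointwise minimum of the chain. The Hall condition only sees finitely
   many indices, where a single member attains it. *)
have [c cP] := choice minF; exists (fun i => c i i); last first.
  by move=> B' FB' i; apply: (cP i).2.
move=> J.
suff [B FB BJ] : exists2 B, F B & forall i, i \in J -> B i = c i i.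
  by rewrite -(eq_bigfcup BJ); exact: Fhall.
elim/finSet_rect: J => J IH.
have [->|[i iJ]] := fset_0Vmem J; first by exists B0.
have [B FB BJ] := IH _ (fproperD1 iJ).
have caseJ k : k \in J -> k = i \/ k \in (J `\ i)%fset.
  by rewrite !inE => ->; rewrite andbT; case: eqVneq; [left|right].
(* Of [c i] and the member found for [J] without [i], the lower one attains the minimum on all of
   [J]. *)
have [cB|Bc] := Ftot _ _ (cP i).1 FB.
- exists (c i); first exact: (cP i).1.
  move=> k /caseJ[->//|kJ]; apply/eqP; rewrite eqEfsubset; apply/andP; split.
    by rewrite -BJ.
  exact: (cP k).2 (cP i).1.
- exists B => // k /caseJ[->|/BJ//].
  apply/eqP; rewrite eqEfsubset; apply/andP; split; first exact: Bc.
  exact: (cP i).2.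
Qed.

(** Zorn's lemma for reverse inclusion: a nonempty chain is bounded by its pointwise minimum, the
    empty one by [A]. *)
Lemma hall_minimal (I U : choiceType) (A : I -> {fset U}) : hall A ->
  exists B, [/\ hall B, subfamily B A &
    forall B', hall B' -> subfamily B' B -> B' = B].
Proof.
move=> hallA.
pose T := {B : I -> {fset U} | hall B /\ subfamily B A}.
pose leT (B B' : T) : bool := `[< subfamily (sval B') (sval B) >].
have A0 : T by exists A; split.
have [|||B Bmax] := @ZL_preorder T A0 leT.
- by move=> B; apply/asboolP.
- move=> B1 B2 B3 /asboolP h12 /asboolP h23; apply/asboolP => i.
  exact: fsubset_trans (h23 i) (h12 i).
- move=> F Ftot.
  have [F0|/existsNP[B0 /contrapT FB0]] := pselect (forall B, ~ F B).
    by exists A0 => B /F0.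
  have [|_ [C _ <-]|_ _ [C FC <-] [D FD <-]|B hallB BF] :=
      @hall_chain_inf _ _ (sval @` F) (sval B0).
  + by exists B0.
  + exact: (svalP C).1.
  + by have [/asboolP|/asboolP] := Ftot _ _ FC FD; [right|left].
  + have BA : subfamily B A.
      move=> i; apply: fsubset_trans ((svalP B0).2 i).
      by apply: BF; exists B0.
    exists (exist _ B (conj hallB BA)) => C FC; apply/asboolP.
    by apply: BF; exists C.
case: B Bmax => B [hallB BA] Bmax; exists B; split=> // B' hallB' B'B.
have B'A : subfamily B' A by move=> i; apply: fsubset_trans (BA i).
have := Bmax (exist _ B' (conj hallB' B'A)); rewrite /leT/=.
move=> /(_ (asboolT B'B))/asboolP BB'.
by apply/funext => i; apply/eqP; rewrite eqEfsubset B'B BB'.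
Qed.

(* Rado's argument: if removing x, resp. y, from B i breaks the Hall condition,
   the two violating unions contradict submodularity of the cardinal. *)
Lemma hall_minimal_singleton (I U : choiceType) (B : I -> {fset U}) : hall B ->
  (forall B', hall B' -> subfamily B' B -> B' = B) ->
  forall i x y, x \in B i -> y \in B i -> x = y.
Proof.
move=> hallB Bmin i.
pose del x k := if k == i then (B i `\ x)%fset else B k.
(* By minimality [del x] violates the Hall condition at some set of indices. It must contain [i],
   since elsewhere [del x] agrees with [B]; the [J] given here is that set without [i]. *)
have delP x : x \in B i -> exists J : {fset I},
    i \notin J /\ (#|` (B i `\ x) `|` \bigcup_(k <- J) B k| <= #|` J|)%fset%N.
  move=> xi.
  have /existsNP[J] : ~ hall (del x).
    move=> /Bmin delB; have /(congr1 (fun C => C i)) : del x = B.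
      by apply: delB => k; rewrite /del; case: eqP => // ->; exact: fsubD1set.
    rewrite /del eqxx => Bi; move: xi.
    by rewrite -Bi in_fsetD1 eqxx.
  move=> /negP; rewrite -ltnNge => Jlt.
  have delJ (K : {fset I}) : i \notin K ->
      (\bigcup_(k <- K) del x k = \bigcup_(k <- K) B k)%fset.
    move=> iK; apply: eq_bigfcup => k kK; rewrite /del; case: eqP => // ki.
    by rewrite -ki kK in iK.
  have iJ : i \in J.
    by apply: contraLR Jlt => iJ; rewrite -leqNgt delJ.
  exists (J `\ i)%fset; split; first by rewrite in_fsetD1 eqxx.
  move: Jlt; rewrite -{1}(fsetD1K iJ) bigfcup_fsetU1 delJ ?in_fsetD1 ?eqxx//.
  by rewrite /del eqxx (cardfsD1 i J) iJ.
move=> x y xi yi; apply/eqP; apply: contrapT => /negP xy.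
have [J [iJ cJ]] := delP _ xi; have [K [iK cK]] := delP _ yi.
set P := (X in (#|` X| <= _)%N) in cJ; set Q := (X in (#|` X| <= _)%N) in cK.
(* As [x] and [y] differ, each element of [B i] survives in [P] or in [Q]. *)
have PQU : ((\bigcup_(k <- i |` (J `|` K)) B k) `<=` P `|` Q)%fset.
  apply/fsubsetP => z; rewrite bigfcup_fsetU1 in_fsetU => /orP[zi|].
    rewrite !inE zi !andbT; case: (eqVneq z x) => [->|//]; rewrite xy.
    by rewrite !orbT.
  case/bigfcupP => k /[!andbT] /[!in_fsetU] /orP[kJ|kK] zk; apply/orP.
    by left; apply/orP; right; apply/bigfcupP; exists k; rewrite ?kJ.
  by right; apply/orP; right; apply/bigfcupP; exists k; rewrite ?kK.
have PQI : ((\bigcup_(k <- J `&` K) B k) `<=` P `&` Q)%fset.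
  apply/fsubsetP => z /bigfcupP[k /[!andbT] /fsetIP[kJ kK] zk].
  rewrite in_fsetI !in_fsetU; apply/andP; split; apply/orP; right;
    by apply/bigfcupP; exists k; rewrite ?kJ ?kK.
have := leq_add (leq_trans (hallB _) (fsubset_leq_card PQU))
                (leq_trans (hallB _) (fsubset_leq_card PQI)).
rewrite cardfsUI cardfsU1 in_fsetU negb_or iJ iK /= -addnA cardfsUI.
by move=> /leq_trans/(_ (leq_add cJ cK)); rewrite add1n ltnn.
Qed.

(** The members of a minimal Hall subfamily are singletons, and the Hall condition on pairs of
    indices makes these distinct. *)
Theorem hall_marriage (I U : choiceType) (A : I -> {fset U}) : hall A ->
  exists2 j : I -> U, injective j & forall i, j i \in A i.
Proof.
move=> /hall_minimal[B [hallB BA /(hall_minimal_singleton hallB) Bsub]].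
have exB i : exists x, x \in B i.
  apply/fset0Pn; rewrite -cardfs_gt0; have := hallB [fset i]%fset.
  by rewrite cardfs1 big_seq_fset1.
have [j jB] := choice exB; exists j => [i k jik|i]; last first.
  exact: (fsubsetP (BA i)).
apply/eqP; apply: contrapT => /negP ik.
have := hallB [fset i; k]%fset; rewrite cardfs2 ik leqNgt => /negP; apply.
rewrite ltnS -[X in (_ <= X)%N]/1%N -(cardfs1 (j i)); apply: fsubset_leq_card.
apply/fsubsetP => x.
move=> /bigfcupP[l /[!andbT] /fset2P[->|->] xl]; apply/fset1P.
  by apply: Bsub (jB _).
by rewrite jik; apply: Bsub (jB _).
Qed.

(** * Invariant means and Folner sets *)

Definition fmulg (K : groupType) (T F : {fset K}) : {fset K} :=
  [fset (t * x)%g | t in T, x in F]%fset.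

Lemma fmulgP (K : groupType) (T F : {fset K}) z :
  reflect (exists t x, [/\ t \in T, x \in F & z = (t * x)%g]) (z \in fmulg T F).
Proof.
apply: (iffP (imfset2P _ _ _ _ _)) => [[t tT [x xF ->]]|[t [x [tT xF ->]]]].
  by exists t, x.
by exists t => //; exists x.
Qed.

Lemma mem_fmulg (K : groupType) (T F : {fset K}) t x :
  t \in T -> x \in F -> (t * x)%g \in fmulg T F.
Proof. by move=> tT xF; apply/fmulgP; exists t, x. Qed.

Lemma fmulgA (K : groupType) : associative (@fmulg K).
Proof.
move=> A B F; apply/fsetP => z.
apply/fmulgP/fmulgP => [[x [_ [xA /fmulgP[y [t [yB tF ->]]] ->]]]|].
  by exists (x * y)%g, t; rewrite mem_fmulg// mulgA.
move=> [_ [t [/fmulgP[x [y [xA yB ->]]] tF ->]]].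
by exists x, (y * t)%g; rewrite mem_fmulg// mulgA.
Qed.

Lemma card_fmulg (K : groupType) (T F : {fset K}) :
  (#|` fmulg T F| <= #|` T| * #|` F|)%N.
Proof.
rewrite -(size_allpairs (fun t x => (t * x)%g)); apply: uniq_leq_size => // z.
by move=> /fmulgP[t [x [tT xF ->]]]; apply/allpairsP; exists (t, x).
Qed.

Definition invariant_mean (R : realType) (K : groupType) (m : set K -> R) :=
  [/\ m setT = 1, (forall A, 0 <= m A),
      (forall A B, A `&` B = set0 -> m (A `|` B) = m A + m B) &
      (forall h A, m ((fun x => (h * x)%g) @` A) = m A)].

Lemma mean_le (R : realType) (K : groupType) (m : set K -> R) A B :
  invariant_mean m -> A `<=` B -> m A <= m B.
Proof.
move=> [_ m0 mU _] AB; rewrite -(setUIDK B A) setIC (setIidl AB).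
by rewrite mU ?lerDl// setDE setIC -setIA [~` _ `&` _]setIC setICr setI0.
Qed.

Lemma mean_bigcup (R : realType) (K : groupType) (m : set K -> R)
    (I : choiceType) (s : seq I) (F : I -> set K) :
  invariant_mean m -> uniq s ->
  {in s &, forall i k, i != k -> F i `&` F k = set0} ->
  m (\bigcup_(i in [set` s]) F i) = \sum_(i <- s) m (F i).
Proof.
move=> [_ _ mU _]; have m0 : m set0 = 0.
  have := mU set0 set0 (set0I _); rewrite setU0 => /eqP.
  by rewrite -subr_eq subrr => /eqP.
rewrite bigcup_seq; elim: s => [|i s IH] /=; first by rewrite !big_nil.
move=> /andP[is_ us] dF; rewrite !big_cons mU ?IH//.
  by move=> j k js ks; apply: dF; rewrite inE ?js ?ks orbT.
rewrite -bigcup_seq setI_bigcupr bigcup0// => k ks; apply: dF.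
- by rewrite mem_head.
- by rewrite inE ks orbT.
- by apply: contraNneq is_ => ->.
Qed.

(* Such a map is a translation on each of finitely many pieces. *)
Lemma mean_range (R : realType) (K : groupType) (m : set K -> R) (T : {fset K})
    (f : K -> K) :
  invariant_mean m -> injective f -> (forall x, f x \in fmulg T [fset x]%fset) ->
  m (range f) = 1.
Proof.
move=> mm finj fT; have [mT _ _ mL] := mm.
pose A t := [set x | f x = (t * x)%g].
have fP x : exists2 t, t \in T & f x = (t * x)%g.
  by have /fmulgP[t [y [tT /fset1P -> ->]]] := fT x; exists t.
have -> : range f = \bigcup_(t in [set` T]) ((fun x => (t * x)%g) @` A t).
  apply/seteqP; split=> [_ [x _ <-]|_ [t _ [x fx <-]]]; last by exists x.
  by have [t tT ft] := fP x; exists t => //; exists x.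
(* The translated pieces are disjoint because [f] is injective; the pieces themselves because [f x]
   determines [t]. *)
rewrite mean_bigcup//; last first.
  move=> t u _ _ tu; rewrite -subset0 => _ [[x fx <-] [y fy]].
  rewrite -fx -fy => /finj yx; move: tu; rewrite -yx in fx.
  by move: fy; rewrite /A/= fx => /mulIg ->; rewrite eqxx.
under eq_bigr do rewrite mL.
rewrite -mean_bigcup//; last first.
  move=> t u _ _ tu; rewrite -subset0 => x [/= ft].
  by rewrite /A/= ft => /mulIg ut; rewrite ut eqxx in tu.
suff -> : \bigcup_(t in [set` T]) A t = setT by [].
by apply/seteqP; split=> // x _; have [t tT ft] := fP x; exists t.
Qed.

(** If every [F] doubled, Hall's theorem for two copies of [K], with [T x] allotted to both copies
    of [x], would give two disjoint ranges of mass 1 each. *)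
Lemma mean_no_doubling (R : realType) (K : groupType) (m : set K -> R)
    (T : {fset K}) : invariant_mean m ->
  exists F : {fset K}, (#|` fmulg T F| < 2 * #|` F|)%N.
Proof.
move=> mm; apply: contrapT => /forallNP dbl.
pose A (p : K * bool) := fmulg T [fset p.1]%fset.
have [|j jinj jA] := @hall_marriage _ _ A.
  move=> J; pose F := [fset p.1 | p in J]%fset.
  have J2 : (#|` J| <= 2 * #|` F|)%N.
    rewrite mulnC -(size_allpairs pair _ [:: true; false]).
    apply: uniq_leq_size => // -[x b] pJ; apply/allpairsP; exists (x, b).
    split=> //=; last by case: b {pJ}.
    by apply/imfsetP; exists (x, b).
  apply: leq_trans J2 _; have /negP := dbl F; rewrite -leqNgt => /leq_trans; apply.
  apply: fsubset_leq_card; apply/fsubsetP => z /fmulgP[t [x [tT + ->]]].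
  move=> /imfsetP[p /= pJ ->]; apply/bigfcupP; exists p; first by rewrite andbT.
  by apply: mem_fmulg; rewrite ?inE.
have mj b : m (range (fun x => j (x, b))) = 1.
  apply: mean_range mm _ _ => [x y /jinj[]//|x]; exact: jA.
have [mT _ mU _] := mm.
have := mean_le mm (@subsetT _ (range (fun x => j (x, true)) `|`
                                range (fun x => j (x, false)))).
rewrite mU ?mj ?mT; last first.
  by rewrite -subset0 => _ [[x _ <-] [y _ /jinj]].
by rewrite -subr_ge0 opprD addrA subrr sub0r oppr_ge0 ler10.
Qed.

Fixpoint fexpg (K : groupType) (T : {fset K}) n : {fset K} :=
  if n is n'.+1 then fmulg T (fexpg T n') else [fset 1%g]%fset.

(** If each [F] grew by the factor [1 + e] under [T], a power of [T] would double every finite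
    set. *)
Theorem folner (R : realType) (K : groupType) (m : set K -> R) (T : {fset K})
    (e : R) : invariant_mean m -> 0 < e ->
  exists F : {fset K}, #|` fmulg T F|%:R < (1 + e) * #|` F|%:R.
Proof.
move=> mm e0; apply: contrapT => /forallNP noF.
have grow n F : (1 + e) ^+ n * #|` F|%:R <= #|` fmulg (fexpg T n) F|%:R.
  elim: n => [|n IH] /=.
    rewrite expr0 mul1r ler_nat; apply: fsubset_leq_card; apply/fsubsetP => x xF.
    by rewrite -[x]mul1g mem_fmulg ?inE.
  rewrite -fmulgA exprS -mulrA.
  apply: le_trans (_ : (1 + e) * #|` fmulg (fexpg T n) F|%:R <= _).
    by rewrite ler_wpM2l// addr_ge0// ltW.
  by rewrite leNgt; apply/negP/noF.
(* Bernoulli's inequality, with [n] at least the inverse of [e]. *)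
have [n n2] : exists n, 2 <= (1 + e) ^+ n.
  exists (Num.bound e^-1); apply: le_trans (_ : 1 + e *+ Num.bound e^-1 <= _).
    rewrite lerD2l// -mulr_natr -ler_pdivrMl// mulr1 ltW//.
    by rewrite archi_boundP// invr_ge0 ltW.
  elim: (Num.bound _) => [|k IH]; first by rewrite mulr0n addr0 expr0.
  rewrite exprS mulrS; move: IH; set u := _ *+ _; set v := _ ^+ _ => IH.
  have u0 : 0 <= u by rewrite mulrn_wge0// ltW.
  by nra.
have [F] := mean_no_doubling (fexpg T n) mm.
apply/negP; rewrite -leqNgt -(ler_nat R) natrM; apply: le_trans (grow n F).
by rewrite ler_wpM2r.
Qed.

(** * A lower bound for the rank of a matrix *)

Local Open Scope sesquilinear_scope.

Lemma dotmx_row (C : numClosedFieldType) m n (A B : 'M[C]_(m, n)) i k :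
  dotmx (row i A) (row k B) = (A *m B^t*) i k.
Proof. by rewrite dotmxE !mxE; apply: eq_bigr => l _; rewrite !mxE. Qed.

Lemma dotmx_sqnorm (C : numClosedFieldType) n (u : 'rV[C]_n) :
  dotmx u u = \sum_k `|u 0 k| ^+ 2.
Proof. by rewrite dotmxE mxE; apply: eq_bigr => k _; rewrite !mxE normCK. Qed.

(* Factor M = A B with orthonormal rows in B; then |M i i|^2 is at most the
   squared norm of row i of A, which is that of row i of M, times that of
   column i of B, and the latter add up to the rank. *)
Lemma mxrank_diag (C : numClosedFieldType) n (M : 'M[C]_n) (c d : C) :
  0 <= c -> (forall i, d <= `|M i i| ^+ 2) ->
  (forall i, \sum_j `|M i j| ^+ 2 <= c) ->
  n%:R * d <= c * (\rank M)%:R.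
Proof.
move=> c0 Md Mc.
have [r [B [-> Bu /submxP[A MAB]]]] : exists r (B : 'M[C]_(r, n)),
    [/\ \rank M = r, B \is unitarymx & (M <= B)%MS].
  exists (\rank M), (schmidt (row_base M)); split=> //.
    by rewrite schmidt_unitarymx// rank_leq_col.
  by rewrite (eqmx_schmidt_free (row_base_free M)) eq_row_base.
have MA i : \sum_j `|M i j| ^+ 2 = dotmx (row i A) (row i A).
  transitivity (dotmx (row i M) (row i M)).
    by rewrite dotmx_sqnorm; apply: eq_bigr => j _; rewrite mxE.
  by rewrite !dotmx_row {2}MAB trmx_mul map_mxM mulmxA MAB mulmxtVK.
have Mii i : M i i = dotmx (row i A) (row i (B^t*)).
  by rewrite dotmx_row trmxCK -MAB.
have le i : d <= c * \sum_k `|B k i| ^+ 2.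
  apply: le_trans (Md i) _; rewrite Mii.
  apply: le_trans (_ : dotmx (row i A) (row i A) *
                       dotmx (row i (B^t*)) (row i (B^t*)) <= _).
    exact: (CauchySchwarz (@dotmx C _) _ _).1.
  rewrite -MA [X in _ * X]dotmx_sqnorm.
  under [X in _ * X <= _]eq_bigr do rewrite !mxE norm_conjC.
  by rewrite ler_wpM2r// sumr_ge0// => k _; rewrite exprn_ge0.
have -> : r%:R = \sum_i \sum_k `|B k i| ^+ 2 :> C.
  rewrite exchange_big/= -[LHS]mulr_natl mulr1 -[X in X%:R]card_ord -sumr_const.
  apply: eq_bigr => k _; transitivity (dotmx (row k B) (row k B)).
    by rewrite dotmx_row (unitarymxP Bu) mxE eqxx.
  by rewrite dotmx_sqnorm; apply: eq_bigr => j _; rewrite mxE.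
rewrite mulr_sumr -[X in X%:R]card_ord mulr_natl -sumr_const.
by apply: ler_sum => i _.
Qed.

(** * From a square-summable solution to a finitely supported one *)

Lemma sqr_norm_cnorm2 (R : realType) (z : R[i]) : `|z| ^+ 2 = (cnorm2 z)%:C%C.
Proof.
by rewrite normc_def -rmorphXn/= sqr_sqrtr// addr_ge0// sqr_ge0.
Qed.

Lemma cnorm2_ge0 (R : realType) (z : R[i]) : 0 <= cnorm2 z.
Proof. by rewrite addr_ge0// sqr_ge0. Qed.

Definition sq_summable (R : realType) (K : choiceType) (x : K -> R[i]) :=
  exists c : R, forall F : {fset K}, \sum_(k <- F) cnorm2 (x k) <= c.

(* Elek's argument: by [mxrank_diag] the right translates of x restricted to a
   finite set F span a space of dimension proportional to |F|, and a maps it to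
   functions on the boundary B of F, which for a Folner set is smaller. *)
Theorem zero_divisor_of_sq_summable (R : realType) (K : groupType)
    (m : set K -> R) (S : {fset K}) (a x : K -> R[i]) (g0 : K) :
  invariant_mean m -> (forall s, s \notin S -> a s = 0) ->
  sq_summable x -> (forall h, \sum_(s <- S) a s * x (s^-1 * h)%g = 0) ->
  x g0 != 0 ->
  exists (F : {fset K}) (b : K -> R[i]),
    [/\ exists k, b k != 0, forall k, k \notin F -> b k = 0 &
        forall h, \sum_(s <- S) a s * b (s^-1 * h)%g = 0].
Proof.
move=> mm aS [c xc] ax0 xg0.
(* The unit puts [F] inside [T F]; the quotients put [s^-1 z] in [T F] for all [s] in [S] as soon as
   [z] is in [S F]. *)
pose T := (1%g |` fmulg [fset s^-1%g | s in S] S)%fset.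
pose d := cnorm2 (x g0).
have d0 : 0 < d by rewrite -ltcR -sqr_norm_cnorm2 exprn_gt0// normr_gt0.
have c0 : 0 < c.
  by apply: lt_le_trans (xc [fset g0]%fset); rewrite big_seq_fset1.
(* Chosen so that [|B| c <= |S| e |F| c < (|S| + 1) e c |F| = d |F|]; the extra 1 makes the
   inequality strict and avoids dividing by 0. *)
pose e := d / (c * (#|` S|.+1)%:R).
have e0 : 0 < e by rewrite divr_gt0// mulr_gt0.
have [F FT] := @folner _ _ _ T _ mm e0.
pose n := #|` F|.
pose B := fmulg S (fmulg T F `\` F)%fset.
have FTF : (F `<=` fmulg T F)%fset.
  by apply/fsubsetP => y yF; rewrite -[y]mul1g mem_fmulg// fset1U1.
have cardB : #|` B|%:R * c < n%:R * d.
  have : (#|` B| + #|` S| * n <= #|` S| * #|` fmulg T F|)%N.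
    rewrite -(cardfsID F (fmulg T F)) (fsetIidPr FTF) mulnDr addnC leq_add2l.
    exact: card_fmulg.
  rewrite -(ler_nat R) natrD !natrM => Ble.
  have n0 : 0 < n%:R :> R.
    rewrite -(pmulr_rgt0 _ (addr_gt0 ltr01 e0)); exact: le_lt_trans FT.
  have dE : d = e * c * (#|` S|%:R + 1).
    by rewrite natr1 /e -mulrA divfK// gt_eqF// mulr_gt0.
  have S0 : 0 <= #|` S|%:R :> R by [].
  move: FT Ble; rewrite -/n dE.
  set b := #|` B|%:R; set t := _%:R; set s := #|` S|%:R; set N := n%:R.
  move=> FT Ble; apply: le_lt_trans (_ : s * (e * N) * c < _).
    rewrite ler_pM2r//; apply: le_trans (_ : s * (t - N) <= _).
      by rewrite mulrBr lerBrDr.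
    by rewrite ler_wpM2l// lerBlDr ltW// (lt_le_trans FT)// mulrDl mul1r addrC.
  have -> : N * (e * c * (s + 1)) = s * (e * N) * c + e * c * N by ring.
  by rewrite ltrDl; do 2?apply: mulr_gt0.
pose y (j : 'I_n) : K := nth 1%g F j.
have yF j : y j \in F by rewrite mem_nth.
have yI : injective y.
  by move=> j k /eqP; rewrite nth_uniq ?fset_uniq// => /eqP/val_inj.
have sumF (V : nmodType) (f : K -> V) : \sum_(j < n) f (y j) = \sum_(k <- F) f k.
  by rewrite (big_nth 1%g) big_mkord.
(* Row [i] is the right translate of [x] by [(y i)^-1 g0], restricted to [F], so that the diagonal
   is constantly [x g0]. The matrix [C] is convolution by [a] on functions on [F], read off on [B]
   only. *)
pose M := \matrix_(i < n, j < n) x (y j * ((y i)^-1 * g0))%g.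
pose C := \matrix_(j < n, l < #|` B|) a (nth 1%g B l * (y j)^-1)%g.
have rkM : (#|` B| < \rank M)%N.
  have : n%:R * d%:C%C <= c%:C%C * (\rank M)%:R.
    apply: mxrank_diag => [|i|i].
    - by rewrite lecR ltW.
    - by rewrite mxE mulgA mulgV mul1g sqr_norm_cnorm2.
    - under eq_bigr do rewrite mxE sqr_norm_cnorm2.
      rewrite -rmorph_sum lecR; set h := (_ * g0)%g.
      rewrite (sumF _ (fun k => cnorm2 (x (k * h)%g))).
      have := xc [fset (k * h)%g | k in F]%fset.
      by rewrite big_imfset//= => k l _ _; exact: mulIg.
  rewrite -!(rmorph_nat (real_complex R)) -!rmorphM/= lecR => rk.
  rewrite -(ltr_nat R) -(ltr_pM2r c0); apply: lt_le_trans cardB _.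
  by rewrite [leRHS]mulrC.
(* For [z] outside [S F] every term vanishes. Otherwise, [z] not being in [B], all [s^-1 z] lie in
   [F]: the restriction to [F] loses nothing and the sum is a value of [a] convolved with a
   translate of [x]. *)
have convM z i : z \notin B -> \sum_j M i j * a (z * (y j)^-1)%g = 0.
  move=> zB.
  have [zSF|zSF] := boolP (z \in fmulg S F); last first.
    apply: big1 => j _; rewrite [a _]aS ?mulr0//; apply: contra zSF => sS.
    by rewrite -[z](mulgVK (y j)) mem_fmulg.
  have sF s : s \in S -> (s^-1 * z)%g \in F.
    move=> sS; apply: contraNT zB => szF.
    rewrite -[z](mulVKg s) mem_fmulg// in_fsetD szF/=.
    have /fmulgP[t [k [tS kF ->]]] := zSF; rewrite mulgA mem_fmulg//.
    apply/fset1UP; right; apply: mem_fmulg => //.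
    by apply/imfsetP; exists s.
  set h := ((y i)^-1 * g0)%g.
  under eq_bigr do rewrite mxE -/h.
  rewrite (sumF _ (fun k => x (k * h)%g * a (z * k^-1)%g)) -[RHS](ax0 (z * h)%g).
  rewrite -(@big_fset_incl _ _ _ _ [fset (s^-1 * z)%g | s in S]%fset) /=.
  - rewrite big_imfset/=; last by move=> s t _ _ /mulIg /invg_inj.
    by apply: eq_bigr => s _; rewrite invgM invgK mulVKg -mulgA mulrC.
  - by apply/fsubsetP => _ /imfsetP[s /= sS ->]; exact: sF.
  - move=> k kF kS; rewrite aS ?mulr0//; apply: contra kS => zk.
    by apply/imfsetP; exists (z * k^-1)%g => //=; rewrite invgM invgK mulgVK.
(* [M C] has rank at most [|B|], less than that of [M], so its left kernel is not contained in that
   of [M]. *)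
have [u uM uMC] : exists2 u : 'rV_n, u *m M != 0 & u *m M *m C = 0.
  have : ~~ (kermx (M *m C) <= kermx M)%MS.
    have ltMC : (\rank (M *m C) < \rank M)%N.
      apply: leq_ltn_trans rkM; apply: leq_trans (mxrankM_maxr M C) _.
      exact: rank_leq_col.
    apply/negP => /mxrankS; rewrite !mxrank_ker leqNgt => /negP; apply.
    exact: ltn_sub2l (leq_trans ltMC (rank_leq_row M)) ltMC.
  move=> /row_subPn[i iM]; exists (row i (kermx (M *m C))).
    by apply: contra iM => /eqP ?; exact/sub_kermxP.
  by rewrite -mulmxA -row_mul mulmx_ker row0.
pose w := u *m M.
have wE z : \sum_j w 0 j * a (z * (y j)^-1)%g = 0.
  have [zB|zB] := boolP (z \in B).
    have zl : (index z B < #|` B|)%N by rewrite index_mem.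
    have /matrixP/(_ 0 (Ordinal zl)) := uMC; rewrite !mxE => {2}<-.
    by apply: eq_bigr => j _; rewrite [C _ _]mxE/= nth_index.
  under eq_bigr do rewrite mxE mulr_suml.
  rewrite exchange_big big1//= => i _.
  by under eq_bigr do rewrite -mulrA; rewrite -mulr_sumr convM// mulr0.
(* The row [w], seen as a function on [F] and extended by zero. *)
pose b k := \sum_j w 0 j *+ (k == y j).
exists F, b; split.
- have /rV0Pn[j wj] := uM; exists (y j); rewrite /b (bigD1 j)//= eqxx mulr1n.
  rewrite big1 ?addr0// => k kj.
  by rewrite (inj_eq yI) eq_sym (negbTE kj) mulr0n.
- move=> k kF; rewrite /b big1// => j _; case: eqP => [kj|//].
  by rewrite kj yF in kF.
- move=> h; rewrite -[RHS](wE h).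
  under eq_bigr do rewrite mulr_sumr.
  rewrite exchange_big; apply: eq_bigr => j _ /=.
  have eqs s : (s^-1 * h == y j)%g = (s == (h * (y j)^-1)%g).
    by apply/eqP/eqP => [<-|->]; rewrite invgM ?invgK ?mulVKg ?mulgVK.
  have [hS|hS] := boolP ((h * (y j)^-1)%g \in S); last first.
    rewrite aS// mulr0 big1_seq//= => s sS; rewrite eqs.
    by case: eqP hS => [<-|_ _]; rewrite ?sS// mulr0n mulr0.
  rewrite (bigD1_seq _ hS) ?fset_uniq//=.
  rewrite eqs eqxx mulr1n mulrC big1 ?addr0// => s sh.
  by rewrite eqs (negbTE sh) mulr0n mulr0.
Qed.

(** * Groups with unbundled operations, and transfer to the subgroup *)

Section GroupLaw.
Context {G : Type} {mul : G -> G -> G} {inv : G -> G} {one : G}.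
Hypothesis Ggrp : group_law mul inv one.

Lemma group_law_mulrV x : mul x (inv x) = one.
Proof.
have [mulA mul1 mulV] := Ggrp.
by rewrite -[LHS]mul1 -{1}(mulV (inv x)) -mulA (mulA (inv x)) mulV mul1 mulV.
Qed.

Lemma group_law_mulr1 x : mul x one = x.
Proof.
have [mulA mul1 mulV] := Ggrp.
by rewrite -(mulV x) mulA group_law_mulrV mul1.
Qed.

Lemma group_law_mulK x y : mul (inv x) (mul x y) = y.
Proof. by have [mulA mul1 mulV] := Ggrp; rewrite mulA mulV mul1. Qed.

Lemma group_law_mulVK x y : mul x (mul (inv x) y) = y.
Proof.
by have [mulA mul1 mulV] := Ggrp; rewrite mulA group_law_mulrV mul1.
Qed.

Lemma group_law_invM x y : inv (mul x y) = mul (inv y) (inv x).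
Proof.
have [mulA mul1 mulV] := Ggrp.
rewrite -[RHS](group_law_mulK (mul x y)) -mulA.
by rewrite group_law_mulVK group_law_mulrV group_law_mulr1.
Qed.

Lemma group_law_divMr x y z : mul (mul x z) (inv (mul y z)) = mul x (inv y).
Proof.
have [mulA _ _] := Ggrp.
by rewrite group_law_invM -mulA group_law_mulVK.
Qed.

Lemma group_law_div_eq x y : mul x (inv y) = one -> x = y.
Proof.
have [mulA mul1 mulV] := Ggrp => xy.
by rewrite -[RHS]mul1 -xy -mulA mulV group_law_mulr1.
Qed.

Lemma group_law_inv_inj : injective inv.
Proof.
move=> x y xy; have [_ _ mulV] := Ggrp.
by rewrite -[LHS]group_law_mulr1 -(mulV y) -xy group_law_mulVK.
Qed.

End GroupLaw.

(** The embedding [v] carries the results on a [groupType] over to the set [H] with the operations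
    of [G]. *)
Lemma subgroup_groupType (G : choiceType) (mul : G -> G -> G) (inv : G -> G)
    (one : G) (H : set G) :
  group_law mul inv one -> is_subgroup mul inv one H ->
  exists (K : groupType) (v : K -> G),
    [/\ injective v, range v = H, {morph v : x y / (x * y)%g >-> mul x y},
        v 1%g = one & {morph v : x / (x^-1)%g >-> inv x}].
Proof.
move=> Ggrp [H1 HM HV]; have [mulA mul1 mulV] := Ggrp.
pose mulH (x y : set_type H) : set_type H :=
  exist (fun z => z \in H) _
    (mem_set (HM _ _ (set_mem (svalP x)) (set_mem (svalP y)))).
pose invH (x : set_type H) : set_type H :=
  exist (fun z => z \in H) _ (mem_set (HV _ (set_mem (svalP x)))).
pose oneH : set_type H := exist (fun z => z \in H) _ (mem_set H1).
have mulHA : associative mulH by move=> x y z; apply/val_inj/mulA.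
have mul1H : left_id oneH mulH by move=> x; apply/val_inj/mul1.
have mulH1 : right_id oneH mulH by move=> x; apply/val_inj/(group_law_mulr1 Ggrp).
have mulVH : left_inverse oneH invH mulH by move=> x; apply/val_inj/mulV.
have mulHV : right_inverse oneH invH mulH.
  by move=> x; apply/val_inj/(group_law_mulrV Ggrp).
pose K : groupType := HB.pack (set_type H)
  (isGroup.Build (set_type H) mulHA mul1H mulH1 mulVH mulHV).
exists K, (fun x : set_type H => val x); split=> //.
apply/seteqP; split=> [_ [x _ <-]|h Hh]; first exact: set_mem (svalP x).
by exists (exist (fun z => z \in H) h (mem_set Hh)).
Qed.

(** Pulled back along [v], a nonzero value of [x] on [H] would yield a finitely supported [b] killed
    by [a]; extended by zero to [G], it contradicts [non_zerodivisor]. *)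
Lemma sq_summable_gr_act_inj (R : realType) (G : choiceType)
    (mul : G -> G -> G) (inv : G -> G) (one : G) (H : set G) (a x : G -> R[i]) :
  group_law mul inv one -> is_subgroup mul inv one H ->
  amenable_discrete R mul H -> in_group_ring H a -> non_zerodivisor mul inv H a ->
  (exists c : R, forall F : {fset G}, [set` F] `<=` H ->
     \sum_(k <- F) cnorm2 (x k) <= c) ->
  (forall h, H h -> gr_act mul inv a x h = 0) ->
  forall h, H h -> x h = 0.
Proof.
move=> Ggrp Hsub [m [mH m0 mU mL]] [afin aH] anzd [c xc] ax0 h0 Hh0.
have [mulA mul1 mulV] := Ggrp.
have [K [v [vI vH vM v1 vV]]] := subgroup_groupType Ggrp Hsub.
have Hv k : H (v k) by rewrite -vH; exists k.
have HvP h : H h -> exists k, h = v k by rewrite -vH => -[k _ <-]; exists k.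
have imH (A : set K) : v @` A `<=` H by move=> _ [k _ <-].
apply/eqP; apply: contrapT => /negP xh0.
pose S := fset_set (v @^-1` csupport a).
have Sfin : finite_set (v @^-1` csupport a).
  by apply: finite_preimage => // k l _ _ /vI.
have memS s : (s \in S) = (a (v s) != 0).
  by rewrite in_fset_set//; apply/idP/idP => [/set_mem|/mem_set].
have sumS (f : G -> R[i]) :
    \sum_(h \in csupport a) f h = \sum_(s <- S) f (v s).
  rewrite fsbig_finite//.
  have -> : fset_set (csupport a) = [fset v s | s in S]%fset.
    apply/fsetP => h; rewrite in_fset_set//; apply/idP/imfsetP => /=.
      move=> /set_mem ah; have [k hk] := HvP _ (aH _ ah).
      by exists k => //; rewrite memS -hk.
    by move=> [k]; rewrite memS => ak ->; apply/mem_set.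
  by rewrite big_imfset//= => k l _ _ /vI.
have [k0 k0E] := HvP _ Hh0.
have [||||//|F [b [[k bk] bF ab]]] := @zero_divisor_of_sq_summable R K
    (fun A => m (v @` A)) S (a \o v) (x \o v) k0.
- split=> [|A|A B AB|h A].
  + by rewrite vH.
  + exact/m0/imH.
  + rewrite image_setU mU//; rewrite -subset0 => _ [[k Ak <-] [l Bl /vI lk]].
    have : (A `&` B) k by split=> //; rewrite -lk.
    by rewrite AB.
  + rewrite -(mL (v h) (v @` A) (Hv h) (@imH A)) !image_comp.
    congr (m _); apply: eq_imagel => k _ /=; exact: vM.
- by move=> s; rewrite memS negbK => /eqP.
- exists c => F; have := xc [fset v k | k in F]%fset.
  rewrite big_imfset/=; last by move=> k l _ _ /vI.
  by apply=> h /imfsetP[k _ ->]; exact: Hv.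
- move=> h; rewrite -[RHS](ax0 _ (Hv h)) /gr_act sumS.
  by apply: eq_bigr => s _ /=; rewrite /left_transl vM vV.
- by rewrite /= -k0E.
pose b' g :=
  if pselect (exists k, g = v k) is left e then b (projT1 (cid e)) else 0.
have b'v l : b' (v l) = b l.
  rewrite /b'; case: pselect => [e|]; last by case; exists l.
  by case: cid => l' /= /vI ->.
have b'0 g : ~ H g -> b' g = 0.
  by move=> Hg; rewrite /b'; case: pselect => // -[l gl]; case: Hg; rewrite gl.
have b'H : in_group_ring H b'.
  split; last first.
    by move=> g /=; rewrite /csupport/= => /eqP b'g; apply: contrapT => /b'0.
  apply: (@sub_finite_set _ _ (v @` [set` F])); last exact: finite_image.
  move=> g; rewrite /csupport/= => b'g.
  have [l gl] : exists l, g = v l.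
    by apply: HvP; apply: contrapT => /b'0 g0; rewrite g0 eqxx in b'g.
  exists l => //=; apply: contraNT b'g => lF; by rewrite gl b'v bF.
have [|+ _] := anzd b' b'H.
  by move=> /(congr1 (fun f => f (v k))); rewrite b'v; apply/eqP.
apply; apply/funext => g; rewrite /gr_mul sumS.
have [/HvP[l ->]|Hg] := pselect (H g).
  by rewrite -[RHS](ab l); apply: eq_bigr => s _; rewrite -vV -vM b'v.
(* Off [H] the product vanishes, since [s^-1 g] is in [H] only if [g] is. *)
apply: big1 => s _; rewrite b'0 ?mulr0// => Hsg; apply: Hg.
have [_ HM _] := Hsub.
by rewrite -(group_law_mulVK Ggrp (v s) g); exact: HM.
Qed.

(** * Discrete subgroups and countable covers *)

Section TopologicalGroup.
Context {G : ptopologicalType} {mul : G -> G -> G} {inv : G -> G} {one : G}.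
Hypothesis Gtop : topological_group mul inv one.

Lemma continuous_mull (g : G) : continuous (mul g).
Proof.
have [_ mulC _] := Gtop => x.
apply: (@continuous_comp _ _ _ (fun y : G => (g, y)) (fun p => mul p.1 p.2)).
  by apply: cvg_pair => //; exact: cvg_cst.
exact: mulC.
Qed.

Lemma continuous_mulr (g : G) : continuous (mul^~ g).
Proof.
have [_ mulC _] := Gtop => x.
apply: (@continuous_comp _ _ _ (fun y : G => (y, g)) (fun p => mul p.1 p.2)).
  by apply: cvg_pair => //; exact: cvg_cst.
exact: mulC.
Qed.

Lemma continuous_divg : continuous (fun p : G * G => mul p.1 (inv p.2)).
Proof.
have [_ mulC invC] := Gtop => p.
apply: (@continuous_comp _ _ _ (fun q : G * G => (q.1, inv q.2))
                               (fun q => mul q.1 q.2)); last exact: mulC.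
apply: cvg_pair; first exact: cvg_fst.
apply: (@continuous_comp _ _ _ snd inv); [exact: cvg_snd|exact: invC].
Qed.

(** Continuity of [x y^-1] at the unit: small [W] has its quotients in a neighbourhood meeting [H]
    only in [one]. This is what makes the translates [h W x] disjoint. *)
Lemma discrete_subgroup_nbhs (H : set G) :
  is_subgroup mul inv one H -> discrete_subset H ->
  exists W : set G, [/\ open W, W one &
    forall v w, W v -> W w -> H (mul v (inv w)) -> mul v (inv w) = one].
Proof.
move=> [H1 _ _] /(_ _ H1)[U [oU U1 UH]]; have [Ggrp _ _] := Gtop.
have [mulA mul1 mulV] := Ggrp.
have : nbhs (one, one) ((fun p : G * G => mul p.1 (inv p.2)) @^-1` U).
  apply: continuous_divg; apply: open_nbhs_nbhs; split=> //=.
  by rewrite (group_law_mulrV Ggrp).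
case=> -[A B] /= [nA nB] AB; exists (interior (A `&` B)); split.
- exact: open_interior.
- exact/filterI.
- move=> v w /interior_subset[Av _] /interior_subset[_ Bw] Hvw.
  have : (U `&` H) (mul v (inv w)) by split=> //; exact: (AB (v, w)).
  by rewrite UH.
Qed.

(** Each compact [K n] is covered by finitely many of the open translates [W x]. *)
Lemma sigma_compact_countable_cover (W : set G) :
  sigma_compact G -> open W -> W one ->
  exists2 X : set G, countable X &
    forall g, exists2 x, X x & W (mul g (inv x)).
Proof.
move=> [K [Kc KT]] oW W1; have [Ggrp _ _] := Gtop.
pose Wx x := (mul^~ (inv x)) @^-1` W.
have fin n : exists D : {fset G}, K n `<=` cover [set` D] Wx.
  have := Kc n; rewrite compact_cover => /(_ G setT Wx)[x _||D _ KD].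
  - by apply: open_comp => // y _; exact: continuous_mulr.
  - by move=> y _; exists y => //; rewrite /Wx/= (group_law_mulrV Ggrp).
  - by exists D.
have [D DK] := choice fin; exists (\bigcup_n [set` D n]).
  by apply: bigcup_countable => // n _; exact/finite_set_countable.
move=> g; have : [set: G] g by [].
by rewrite -KT => -[n _ /DK[x xD Wg]]; exists x => //; exists n.
Qed.

End TopologicalGroup.

(* Each translate [W x] contains at most one point of H. *)
Lemma discrete_subgroup_countable {G : Type} {mul : G -> G -> G} {inv : G -> G}
    {one : G} (H W X : set G) :
  group_law mul inv one -> is_subgroup mul inv one H ->
  (forall v w, W v -> W w -> H (mul v (inv w)) -> mul v (inv w) = one) ->
  countable X -> (forall g, exists2 x, X x & W (mul g (inv x))) -> countable H.
Proof.
move=> Ggrp [_ HM HV] WH /countable_injP[c cI] WX.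
have [mulA mul1 mulV] := Ggrp.
have /choice[t tP] : forall g, exists x, X x /\ W (mul g (inv x)).
  by move=> g; have [x] := WX g; exists x.
apply/countable_injP; exists (c \o t) => h k /set_mem Hh /set_mem Hk /= ctE.
have thk : t h = t k by apply: cI => //; apply/mem_set; exact: (tP _).1.
have := WH _ _ (tP h).2 (tP k).2; rewrite -thk (group_law_divMr Ggrp).
move=> /(_ (HM _ _ Hh (HV _ Hk))); exact: group_law_div_eq Ggrp _ _.
Qed.

(** * Null sets, Haar measure and square-summable orbits *)

Lemma negligible_bigcup_countable (d : measure_display) (T : measurableType d)
    (R : realType) (mu : {measure set T -> \bar R}) (I : Type) (X : set I)
    (F : I -> set T) :
  countable X -> (forall x, X x -> mu.-negligible (F x)) ->
  mu.-negligible (\bigcup_(x in X) F x).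
Proof.
move=> /countable_injP[c cI] nF.
(* Reindexing by codes: [N k] is the set [F x] with code [k], or empty if no [x] has this code. *)
pose N k := \bigcup_(x in [set x | X x /\ c x = k]) F x.
have nN k : mu.-negligible (N k).
  have [[x [Xx cx]]|nx] := pselect (exists x, X x /\ c x = k); last first.
    apply: negligibleS (negligible_set0 mu) => y [x [Xx cx] _].
    by apply: nx; exists x.
  apply: negligibleS (nF x Xx) => y [z [Xz cz] Fz].
  suff -> : x = z by [].
  by apply: cI; rewrite ?cx ?cz//; exact/mem_set.
apply: negligibleS (negligible_bigcup nN) => y [x Xx Fx].
by exists (c x) => //; exists x.
Qed.

(** Links the orbit bound, over finite subsets of [H], to a series over [nat], which can be
    integrated termwise. *)
Lemma sum_fset_le_nneseries (R : realType) (I : choiceType) (X : set I)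
    (c : I -> nat) (F : {fset I}) (v : I -> R) (u : nat -> \bar R) :
  {in X &, injective c} -> [set` F] `<=` X -> (forall n, (0 <= u n)%E) ->
  (forall k, X k -> u (c k) = (v k)%:E) ->
  ((\sum_(k <- F) v k)%:E <= \sum_(n <oo) u n)%E.
Proof.
move=> cI FX u0 uv; rewrite nneseries_esumT//; apply: esum_ge.
exists [set` [fset c k | k in F]%fset]; first by split.
rewrite fsbig_finite// set_fsetK big_imfset/=; last first.
  by move=> k l kF lF; apply: cI; apply/mem_set/FX.
rewrite -sumEFin le_eqVlt; apply/orP; left; apply/eqP.
by apply: eq_big_seq => k kF; rewrite uv//; exact: FX.
Qed.

Section HaarTranslation.
Context {R : realType} {G : ptopologicalType} {mul : G -> G -> G} {inv : G -> G}
  {one : G} {mu : {measure set (borelG G) -> \bar R}}.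
Hypothesis Gtop : topological_group mul inv one.
Hypothesis muH : left_haar_measure mul mu.

Let Ggrp : group_law mul inv one. Proof. by case: Gtop. Qed.

Lemma measurable_mull (g : G) :
  measurable_fun [set: borelG G] (mul g : borelG G -> borelG G).
Proof.
apply: (@measurability _ _ (borelG G) (borelG G) setT (mul g) (@open G)) => //.
move=> _ [U oU <-]; rewrite setTI.
apply: sub_sigma_algebra; apply: open_comp => // x _.
exact: continuous_mull Gtop _ _.
Qed.

Lemma preimage_mull (g : G) (A : set G) : mul g @^-1` A = mul (inv g) @` A.
Proof.
apply/seteqP; split=> [x Agx|_ [x Ax <-]].
  by exists (mul g x) => //; rewrite (group_law_mulK Ggrp).
by rewrite /preimage/= (group_law_mulVK Ggrp).
Qed.

Lemma haar_preimage (g : G) (A : set (borelG G)) : measurable A ->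
  mu (mul g @^-1` A) = mu A.
Proof. by move=> mA; have [_ muL _ _ _] := muH; rewrite preimage_mull muL. Qed.

Lemma negligible_preimage_mull (g : G) (N : set (borelG G)) :
  mu.-negligible N -> mu.-negligible (mul g @^-1` N : set (borelG G)).
Proof.
move=> [A [mA A0 NA]]; exists (mul g @^-1` A); split.
- by rewrite -[X in measurable X]setTI; exact: measurable_mull.
- by rewrite haar_preimage.
- by move=> x /NA.
Qed.

(** By invariance the pushforward of [mu] under left translation is [mu] itself. *)
Lemma haar_integral_mull (g : G) (E : set (borelG G)) (q : borelG G -> \bar R) :
  measurable E -> measurable_fun E q -> (forall x, 0 <= q x)%E ->
  (\int[mu]_(x in (mul g @^-1` E : set (borelG G))) q (mul g x) =
   \int[mu]_(x in E) q x)%E.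
Proof.
move=> mE mq q0.
rewrite -(ge0_integral_pushforward (measurable_mull g))//.
apply: eq_measure_integral => [|mg A mA _]; first exact: measurable_mull.
exact: (haar_preimage g mA).
Qed.

End HaarTranslation.

(* The translates h W x, h in H, are disjoint, so the integral over W x of
   the sum of |f (h y)|^2 over h in H is at most the integral of |f|^2. *)
Lemma ae_sq_summable_orbit {R : realType} {G : ptopologicalType}
    {mul : G -> G -> G} {inv : G -> G} {one : G}
    {mu : {measure set (borelG G) -> \bar R}} (H W : set G) (x : G)
    (f : G -> R[i]) :
  topological_group mul inv one -> left_haar_measure mul mu ->
  is_subgroup mul inv one H -> countable H -> open W ->
  (forall v w, W v -> W w -> H (mul v (inv w)) -> mul v (inv w) = one) ->
  in_L2 mu f ->
  mu.-negligible [set y : borelG G | W (mul y (inv x)) /\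
    ~ exists c : R, forall F : {fset G}, [set` F] `<=` H ->
        \sum_(k <- F) cnorm2 (f (mul k y)) <= c].
Proof.
move=> Gtop muH [_ HM HV] /countable_injP[c cI] oW WH [mRe mIm f2].
have [Ggrp _ _] := Gtop; have [mulA mul1 mulV] := Ggrp.
pose D : set (borelG G) := (mul^~ (inv x)) @^-1` W.
have mD : measurable D.
  apply: sub_sigma_algebra; apply: open_comp => // y _.
  exact: continuous_mulr Gtop _ _.
pose q (y : borelG G) : \bar R := (cnorm2 (f y))%:E.
have mq : measurable_fun [set: borelG G] q.
  apply/measurable_EFinP; apply: measurable_funD; exact: measurable_funX.
have q0 y : (0 <= q y)%E by rewrite lee_fin cnorm2_ge0.
have mqh h : measurable_fun [set: borelG G] (fun y : borelG G => q (mul h y)).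
  exact: measurableT_comp mq (measurable_mull Gtop h).
(* Partial inverse of the coding [c]; integers that code nothing contribute the zero function and
   the empty set below. *)
pose enumH n : option G :=
  if pselect (exists h, H h /\ c h = n) is left e then Some (projT1 (cid e))
  else None.
have enumHP n h : enumH n = Some h -> H h /\ c h = n.
  by rewrite /enumH; case: pselect => // e [<-]; case: cid.
have enumHc h : H h -> enumH (c h) = Some h.
  move=> Hh; rewrite /enumH; case: pselect => [e|]; last by case; exists h.
  case: cid => k /= [Hk ck]; congr Some; apply: cI => //; exact/mem_set.
pose u n (y : borelG G) : \bar R :=
  if enumH n is Some h then q (mul h y) else 0%E.
have u0 n y : (0 <= u n y)%E by rewrite /u; case: (enumH n).
have mu_ n : measurable_fun D (u n).
  rewrite /u; case: (enumH n) => [h|]; last exact: measurable_cst.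
  exact: measurable_funS (mqh h).
(* The translate [h D], where [D] is [W x]. *)
pose E n : set (borelG G) :=
  if enumH n is Some h then mul (inv h) @^-1` D else set0.
have mE n : measurable (E n).
  rewrite /E; case: (enumH n) => [h|]; last exact: measurable0.
  by rewrite -[X in measurable X]setTI; exact: (measurable_mull Gtop).
have tE : trivIset setT E.
  move=> i j _ _ [z []]; rewrite /E.
  case hi : (enumH i) => [h|//]; case kj : (enumH j) => [k|//].
  have [Hh <-] := enumHP _ _ hi; have [Hk <-] := enumHP _ _ kj.
  rewrite /D /preimage/= -!mulA => Wh Wk; congr c.
  apply: (group_law_inv_inj Ggrp); apply: (group_law_div_eq Ggrp).
  rewrite -(group_law_divMr Ggrp _ _ (mul z (inv x))); apply: WH => //.
  by rewrite (group_law_divMr Ggrp); exact: HM (HV _ Hh) (HV _ (HV _ Hk)).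
have intu n : (\int[mu]_(y in D) u n y = \int[mu]_(y in E n) q y)%E.
  rewrite /u /E; case: (enumH n) => [h|]; last by rewrite integral0 integral_set0.
  have DE : mul h @^-1` (mul (inv h) @^-1` D) = D.
    by apply/seteqP; split=> y; rewrite /preimage/= (group_law_mulK Ggrp).
  rewrite -[RHS](haar_integral_mull Gtop muH h); first by rewrite DE.
  - by rewrite -[X in measurable X]setTI; exact: (measurable_mull Gtop).
  - exact: measurable_funS mq.
  - exact: q0.
have fin : (\int[mu]_(y in D) \sum_(n <oo) u n y < +oo)%E.
  rewrite integral_nneseries//; under eq_eseriesr do rewrite intu.
  rewrite -(ge0_integral_bigcup mu mE)//; last exact: measurable_funS mq.
  apply: le_lt_trans f2; apply: ge0_subset_integral => //.
  exact: bigcup_measurable.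
(* A nonnegative series with finite integral is finite almost everywhere, and its sum is the
   required bound. *)
have /(integrable_ae mD) : mu.-integrable D (fun y => \sum_(n <oo) u n y)%E.
  apply/integrableP; split.
    exact: (@ge0_emeasurable_sum _ _ _ _ _ xpredT).
  by under eq_integral do rewrite gee0_abs ?nneseries_ge0//.
apply: negligibleS => y [Dy nb] /(_ Dy) fy; apply: nb.
exists (fine (\sum_(n <oo) u n y)%E) => F FH.
rewrite -lee_fin fineK//.
apply: (sum_fset_le_nneseries cI FH (u := u^~ y)) => // k Hk.
by rewrite /u enumHc.
Qed.

(** * Reduction of the theorem to almost every orbit *)

Theorem theorem5p4 (R : realType) (G : ptopologicalType)
    (mul : G -> G -> G) (inv : G -> G) (one : G)
    (mu : {measure set (borelG G) -> \bar R}) (H : set G) (a : G -> R[i]) :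
  topological_group mul inv one ->
  hausdorff_space G ->
  locally_compact [set: G] ->
  sigma_compact G ->
  left_haar_measure mul mu ->
  is_subgroup mul inv one H ->
  discrete_subset H ->
  amenable_discrete R mul H ->
  in_group_ring H a ->
  non_zerodivisor mul inv H a ->
  forall f : G -> R[i], in_L2 mu f -> ~ ae_zero mu f ->
    ~ ae_zero mu (gr_act mul inv a f).
Proof.
move=> Gtop _ _ Gsc muH Hsub Hd Ham aH anzd f f2 nf0 af0; apply: nf0.
have [Ggrp _ _] := Gtop; have [mulA mul1 mulV] := Ggrp; have [H1 _ _] := Hsub.
have [W [oW W1 WH]] := discrete_subgroup_nbhs Gtop Hsub Hd.
have [X Xc XW] := sigma_compact_countable_cover Gtop Gsc oW W1.
have Hc := discrete_subgroup_countable Ggrp Hsub WH Xc XW.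
(* Outside this set [a * f] vanishes on the whole orbit [H y], not only at [y]; countability of [H]
   keeps it null. *)
have n1 : mu.-negligible (\bigcup_(h in H)
    (mul h @^-1` [set y : borelG G | gr_act mul inv a f y <> 0])).
  apply: negligible_bigcup_countable => // h _.
  exact: (negligible_preimage_mull Gtop muH h af0).
have n2 := negligible_bigcup_countable Xc (fun x (_ : X x) =>
  ae_sq_summable_orbit x Gtop muH Hsub Hc oW WH f2).
apply: negligibleS (negligibleU n1 n2) => x fx0; apply: contrapT => nx; apply: fx0.
(* The value of [f] at [x] is that of the orbit function at the unit of [H]. *)
rewrite /= -[x]mul1; apply: (sq_summable_gr_act_inj
  (x := fun h => f (mul h x)) Ggrp Hsub Ham aH anzd _ _ H1).
  have [y Xy Wxy] := XW x; apply: contrapT => nb; apply: nx; right.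
  by exists y.
move=> h Hh; apply: contrapT => ne0; apply: nx; left; exists h => //=.
move=> afx; apply: ne0; rewrite -[RHS]afx /gr_act.
by apply: eq_fsbigr => k _; rewrite /left_transl mulA.
Qed.
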